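(* Let $\mathfrak g$ be a finite-dimensional real vector space with a lattice $\mathfrak g_{\mathbb Z}\subset\mathfrak g$. Let $P_1,P_2\subset\mathfrak g^*$ be rational polyhedra such that $P_1\cap P_2\neq\emptyset$ has at least one vertex. The following are equivalent: (1) $P_1$ and $P_2$ intersect integrally transversely (i.e. at all points of $P_1\cap P_2$); (2) $P_1$ and $P_2$ intersect integrally transversely at all vertices of $P_1\cap P_2$.
   Context: $\mathfrak g_{\mathbb Z}^*=\{\xi\in\mathfrak g^*\mid \xi(\mathfrak g_{\mathbb Z})\subseteq\mathbb Z\}$ is the dual lattice. A polyhedron $P\subseteq\mathfrak g^*$ is a finite intersection of affine closed half-spaces $\{\xi\mid\langle\xi,v_i\rangle\ge c_i\}$, $v_i\in\mathfrak g$, $c_i\in\mathbb R$; it is rational if the $v_i$ can be taken in $\mathfrak g_{\mathbb Z}$. For $\xi\in P$, if $F$ is the unique face of $P$ containing $\xi$ in its relative interior, $L_\xi P=\mathrm{Span}_{\mathbb R}(F-\xi)$; $\mathrm{dir}(P)$ is the linear subspace of which the affine hull of $P$ is a translate. Rational polyhedra $P_1,P_2$ intersect integrally transversely at $\xi\in P_1\cap P_2$ if $$(L_\xi P_1\cap\mathfrak g_{\mathbb Z}^* )+(L_\xi P_2\cap\mathfrak g_{\mathbb Z}^* )=(\mathrm{dir}(P_1)\cap\mathfrak g_{\mathbb Z}^* )+(\mathrm{dir}(P_2)\cap\mathfrak g_{\mathbb Z}^* ),$$ and they intersect integrally transversely if this holds at every $\xi\in P_1\cap P_2$. *)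

(* Defs.v *)
From mathcomp Require Export all_boot all_order all_algebra.
From mathcomp Require Export all_classical all_reals all_analysis.
Export Order.TTheory GRing.Theory Num.Theory.
Export numFieldNormedType.Exports.

Set Implicit Arguments.
Unset Strict Implicit.
Unset Printing Implicit Defensive.

Local Open Scope classical_set_scope.
Local Open Scope ring_scope.

Definition minkowski_sum (V : zmodType) (A B : set V) : set V :=
  [set a + b | a in A & b in B].

Section Affine.
Variables (R : realType) (V : vectType R).
Implicit Types A F : set V.

(* [A] may be infinite, whereas [span s] is the span of a finite sequence. *)
Definition linear_span A : set V :=
  [set v | exists2 s : seq V, (forall x, x \in s -> A x) & v \in span s].

Definition affine_hull A : set V :=
  [set y | exists (n : nat) (x : 'I_n -> V) (a : 'I_n -> R),
     [/\ forall i, A (x i), \sum_i a i = 1 & y = \sum_i a i *: x i]].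

(* The linear subspace of which [affine_hull A] is a translate. *)
Definition direction A : set V :=
  [set x - y | x in affine_hull A & y in affine_hull A].

(* The interior of [F] relative to its affine hull; the topology of the
   finite-dimensional space [V] is that of the row vectors of coordinates in
   some basis, on which it does not depend. *)
Definition relative_interior F : set V :=
  let e := vbasis {:V} in
  [set x | F x /\
     \forall w \near passmx.rVof e x,
       affine_hull F (passmx.vecof e w) -> F (passmx.vecof e w)].

End Affine.

Section Polyhedra.
Variables (R : realType) (g : vectType R).
Local Notation gdual := 'Hom(g, R^o).
Implicit Types (gZ : set g) (P F : set gdual) (xi : gdual).

(* A full-rank lattice: the integral span of a basis of [g]. *)
Definition is_lattice gZ : Prop :=
  exists2 b : (\dim {:g}).-tuple g,
    basis_of {:g} b & gZ = [set v | inIntSpan b v].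

Definition dual_lattice gZ : set gdual :=
  [set xi : gdual | forall v, gZ v -> (xi v : R) \is a Num.int].

Definition half_space (v : g) (c : R) : set gdual :=
  [set xi : gdual | c <= (xi v : R)].

Definition rational_polyhedron gZ P : Prop :=
  exists2 s : seq (g * R), (forall h, h \in s -> gZ h.1) &
    P = \bigcap_(h in [set` s]) half_space h.1 h.2.

(* A nonempty set of the points of [P] at which some valid inequality of [P] is
   an equality; [v = 0] and [c = 0] give [P] itself. *)
Definition is_face P F : Prop :=
  F !=set0 /\
  exists (v : g) (c : R), P `<=` half_space v c /\
    F = P `&` [set xi : gdual | (xi v : R) = c].

Definition is_vertex P xi : Prop := is_face P [set xi].

(* [L_xi P]: the face [F] is unique when [P] is a polyhedron containing [xi]. *)
Definition face_direction P xi : set gdual :=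
  [set eta | exists F, [/\ is_face P F, relative_interior F xi &
     linear_span [set zeta - xi | zeta in F] eta]].

Definition integrally_transverse_at gZ P1 P2 xi : Prop :=
  minkowski_sum (face_direction P1 xi `&` dual_lattice gZ)
                (face_direction P2 xi `&` dual_lattice gZ) =
  minkowski_sum (direction P1 `&` dual_lattice gZ)
                (direction P2 `&` dual_lattice gZ).

Definition integrally_transverse gZ P1 P2 : Prop :=
  forall xi, (P1 `&` P2) xi -> integrally_transverse_at gZ P1 P2 xi.

End Polyhedra.

(* Main.v *)
Require Import Defs.

Set Implicit Arguments.
Unset Strict Implicit.
Unset Printing Implicit Defensive.

(** At a point [xi] of a polyhedron [P], the subspace [L_xi P] is cut out by
    the constraints of [P] that are active at [xi], so it shrinks as the active
    set grows, and it is contained in [dir P].  If [P1 `&` P2] has a vertex, it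
    contains no line, so from any of its points one can move within the current
    face until new constraints become active, and end at a vertex [eta] where
    all constraints active at [xi] are active.  Hence the sum of lattices at
    [xi] lies between the sum at [eta] and the sum for the directions. *)

Local Open Scope classical_set_scope.
Local Open Scope ring_scope.

Lemma count_ltn_sub (T : eqType) (a b : pred T) (s : seq T) :
  subpred a b -> (exists2 x, x \in s & b x && ~~ a x) -> (count a s < count b s)%N.
Proof.
move=> ab [x xs /andP[bx nax]].
rewrite -(size_filter b) -(count_predC a) !count_filter -addn1 leq_add //.
  by apply: sub_count => y ay /=; rewrite ay ab.
by rewrite -has_count; apply/hasP; exists x; rewrite //= nax.
Qed.

Lemma minkowski_sumS (V : zmodType) (A A' B B' : set V) :
  A `<=` A' -> B `<=` B' -> minkowski_sum A B `<=` minkowski_sum A' B'.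
Proof.
by move=> AA' BB' _ [x Ax [y By <-]]; exists x; [exact: AA'|exists y; [exact: BB'|]].
Qed.

(** * Affine hulls, linear spans and short moves along a line *)

Section SpansAndHulls.
Variables (R : realType) (V : vectType R).
Implicit Types (A : set V) (x y v : V).

Lemma affine_hull_shift_span A x v :
  A x -> linear_span [set y - x | y in A] v -> affine_hull A (x + v).
Proof.
move=> Ax [s sA vs].
have sx (j : 'I_(size s)) : A (s`_j + x).
  have [y Ay <-] := sA _ (mem_nth 0 (ltn_ord j)).
  by rewrite subrK.
pose c j := coord (in_tuple s) j v.
have vE : v = \sum_j c j *: s`_j by rewrite {1}(coord_span (X := in_tuple s) vs).
exists (size s).+1,
  (fun i => oapp (fun j : 'I_(size s) => s`_j + x) x (unlift ord0 i)),
  (fun i => oapp c (1 - \sum_j c j) (unlift ord0 i)).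
split=> [i||].
- by case: unliftP => [j|] _ /=.
- rewrite big_ord_recl unlift_none /=.
  under [X in _ + X]eq_bigr do rewrite liftK /=.
  by rewrite subrK.
- rewrite big_ord_recl unlift_none /=.
  under [X in _ = _ + X]eq_bigr do rewrite liftK /= scalerDr.
  by rewrite big_split /= -vE -scaler_suml addrCA -scalerDl subrK scale1r addrC.
Qed.

Lemma direction_linear_span A x :
  A x -> linear_span [set y - x | y in A] `<=` direction A.
Proof.
move=> Ax v Av; exists (x + v); first exact: affine_hull_shift_span.
exists x; last by rewrite addrAC subrr add0r.
rewrite -[x]addr0; apply: affine_hull_shift_span => //.
by exists [::]; rewrite ?mem0v.
Qed.

(** The line through [x] along [v] is continuous in coordinates. This turns the neighbourhoods in
    [relative_interior] into a single positive step. *)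
Lemma near_coordinates_line x v (P : set V) :
  let e := vbasis {:V} in
  (\forall w \near passmx.rVof e x, P (passmx.vecof e w)) ->
  exists2 t : R, 0 < t & P (x + t *: v).
Proof.
move=> e; have eV : basis_of {:V} e := vbasisP _.
have cv : passmx.rVof e x + t *: passmx.rVof e v @[t --> (0 : R)] -->
          passmx.rVof e x.
  rewrite -[X in _ --> X]addr0 -(scale0r (passmx.rVof e v)).
  by apply: cvgD; [exact: cvg_cst|apply: cvgZr_tmp; exact: cvg_id].
move=> /cv /= /nbhs_ballP [d /= d0 Pd].
exists (d / 2); first by rewrite divr_gt0.
have := Pd (d / 2); rewrite /= addrC -passmx.rVof_linear addrC passmx.rVofK //; apply.
by rewrite /ball /= sub0r normrN gtr0_norm ?divr_gt0 // gtr_pMr // invf_lt1 // ltr1n.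
Qed.

End SpansAndHulls.

Section Polyhedron.
Variables (R : realType) (g : vectType R).
Local Notation gdual := 'Hom(g, R^o).
Implicit Types (s : seq (g * R)) (xi eta zeta : gdual) (F : set gdual).

Lemma linear_span_eval0 F (v : g) :
  (forall xi, F xi -> (xi v : R) = 0) ->
  forall eta, linear_span F eta -> (eta v : R) = 0.
Proof.
move=> F0 eta [s sF etas]; rewrite (coord_span (X := in_tuple s) etas) sum_lfunE.
rewrite big1 // => i _; rewrite scale_lfunE F0 ?scaler0 //.
by apply: sF; apply: mem_nth.
Qed.

Lemma affine_hull_eval F (v : g) (c : R) :
  (forall xi, F xi -> (xi v : R) = c) ->
  forall eta, affine_hull F eta -> (eta v : R) = c.
Proof.
move=> Fc eta [n [x [a [Fx a1 ->]]]]; rewrite sum_lfunE.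
under eq_bigr do rewrite scale_lfunE Fc //.
by rewrite -scaler_suml a1 scale1r.
Qed.

Lemma continuous_eval_vecof (v : g) :
  continuous (fun w => passmx.vecof (vbasis {:gdual}) w v : R).
Proof.
pose e := vbasis {:gdual}.
move=> w; rewrite /continuous_at.
have vE u : (passmx.vecof e u v : R) = \sum_i u 0 i * (e`_i v : R).
  rewrite /passmx.vecof sum_lfunE.
  by apply: eq_bigr => i _; rewrite scale_lfunE.
under eq_fun do rewrite vE.
rewrite vE.
apply: (cvg_big (@add_continuous R^o) (nbhs_filter w)) => i _.
by apply: cvgMr_tmp; apply: coord_continuous.
Qed.

(** * Active constraints and the face they define *)

Definition polyhedron s : set gdual :=
  \bigcap_(h in [set` s]) half_space h.1 h.2.

Definition active s xi : {pred g * R} :=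
  [pred h | (h \in s) && ((xi h.1 : R) == h.2)].

(** For [xi] in the polyhedron, this is the face with [xi] in its relative interior. *)
Definition active_face s xi : set gdual :=
  polyhedron s `&` [set eta | {in active s xi, forall h, (eta h.1 : R) = h.2}].

Definition inactive_valid s xi : set gdual :=
  [set eta | {in s, forall h, h \notin active s xi -> h.2 <= (eta h.1 : R)}].

Lemma polyhedron_cat s1 s2 :
  polyhedron (s1 ++ s2) = polyhedron s1 `&` polyhedron s2.
Proof.
apply/seteqP; split=> [xi xis|xi [xi1 xi2] h /=].
  by split=> h /= hs; apply: xis => /=; rewrite mem_cat hs ?orbT.
by rewrite mem_cat => /orP[/xi1|/xi2].
Qed.

(** The sum of the active constraints is a valid inequality, and a sum of nonnegative slacks
    vanishes only if each slack does. With no active constraint the sum is [0 >= 0], which gives the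
    whole polyhedron. *)
Lemma is_face_active_face s xi :
  polyhedron s xi -> is_face (polyhedron s) (active_face s xi).
Proof.
move=> xis; split; first by exists xi; split=> // h /andP[_ /eqP].
pose r := [seq h <- s | active s xi h].
have memr h : (h \in r) = active s xi h.
  by rewrite mem_filter /= -andbA andbC -andbA andbb andbC.
have sumE eta : (eta (\sum_(h <- r) h.1) : R) - \sum_(h <- r) h.2 =
    \sum_(h <- r) ((eta h.1 : R) - h.2).
  by rewrite linear_sum sumrB.
have ge0 eta : polyhedron s eta ->
    forall h, h \in r -> 0 <= (eta h.1 : R) - h.2.
  by move=> etas h; rewrite memr => /andP[hs _]; rewrite subr_ge0; exact: etas.
exists (\sum_(h <- r) h.1), (\sum_(h <- r) h.2); split.
  move=> eta etas; rewrite /half_space /= -subr_ge0 sumE big_seq.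
  by apply: sumr_ge0 => h; apply: ge0.
apply/seteqP; split=> eta [etas /= etaE]; split=> //=.
  apply/eqP; rewrite -subr_eq0 sumE big_seq big1 // => h.
  by rewrite memr => /etaE ->; rewrite subrr.
move: etaE => /eqP; rewrite -subr_eq0 sumE big_seq psumr_eq0; last exact: ge0.
move=> /allP eta0 h; rewrite inE -[_ && _]/(active s xi h) -memr => hr.
by apply/eqP; rewrite -subr_eq0; have /implyP := eta0 h hr; apply.
Qed.

(** The finitely many inactive constraints are strict at [xi], and evaluation is continuous, so near
    [xi] only the active ones can fail. *)
Lemma near_inactive s xi : polyhedron s xi ->
  \forall w \near passmx.rVof (vbasis {:gdual}) xi,
    inactive_valid s xi (passmx.vecof (vbasis {:gdual}) w).
Proof.
move=> xis; pose e := vbasis {:gdual}.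
have eV : basis_of {:gdual} e := vbasisP _.
pose P (i : 'I_(size s)) w := s`_i \notin active s xi ->
  (s`_i).2 <= (passmx.vecof e w (s`_i).1 : R).
have FF := nbhs_filter (passmx.rVof e xi).
suff nearP i : \forall w \near passmx.rVof e xi, P i w.
  have := @filter_forall _ _ P _ FF nearP.
  apply: filterS => w wP h hs.
  have hi : (index h s < size s)%N by rewrite index_mem.
  by have := wP (Ordinal hi); rewrite /P /= nth_index.
have [ai|ai] := boolP (s`_i \in active s xi).
  by refine (nearW FF _) => w; rewrite /P => /negP [].
have is_ : s`_i \in s by apply: mem_nth.
have lti : (s`_i).2 < (passmx.vecof e (passmx.rVof e xi) (s`_i).1 : R).
  rewrite passmx.rVofK // lt_neqAle (xis _ is_) andbT eq_sym.
  by move: ai; rewrite inE is_.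
have := cvgr_gt _ (@continuous_eval_vecof (s`_i).1 (passmx.rVof e xi)) _ lti.
by move=> /(_ FF); refine (@filterS _ _ FF _ _ _) => w /ltW + _.
Qed.

Lemma relative_interior_active_face s xi :
  polyhedron s xi -> relative_interior (active_face s xi) xi.
Proof.
move=> xis; split; first by split=> // h /andP[_ /eqP].
have := near_inactive xis; apply: filterS => w wP wF.
have wE : {in active s xi, forall h,
    (passmx.vecof (vbasis {:gdual}) w h.1 : R) = h.2}.
  by move=> h ha; apply: affine_hull_eval wF => zeta [_]; apply.
split=> // h /= hs; have [ha|] := boolP (h \in active s xi); last exact: wP.
by rewrite /half_space /= wE.
Qed.

(** * The subspace [L_xi P] through active constraints *)

Lemma polyhedron_step s xi eta : polyhedron s xi ->
  {in active s xi, forall h, (eta h.1 : R) = 0} ->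
  exists2 t : R, 0 < t & active_face s xi (xi + t *: eta).
Proof.
move=> xis eta0; have [t t0 tP] := near_coordinates_line eta (near_inactive xis).
have tE : {in active s xi, forall h, ((xi + t *: eta) h.1 : R) = h.2}.
  move=> h ha; rewrite add_lfunE scale_lfunE eta0 // scaler0 addr0.
  by case/andP: ha => _ /eqP.
exists t => //; split=> // h /= hs.
have [ha|] := boolP (h \in active s xi); last exact: tP.
by rewrite /half_space /= tE.
Qed.

Lemma face_directionP s xi eta : polyhedron s xi ->
  face_direction (polyhedron s) xi eta <->
  {in active s xi, forall h, (eta h.1 : R) = 0}.
Proof.
move=> xis; split=> [[F [[_ [v [c [Pvc FE]]]] [Fxi Fnear] etaF]] h ha|eta0].
  have FP : F `<=` polyhedron s by rewrite FE => ? [].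
  apply: linear_span_eval0 etaF => _ [zeta Fzeta <-].
  have /andP[hs /eqP xih] := ha.
  (* Prolong the segment from [zeta] to [xi] slightly beyond [xi], staying in [F]. The constraint
     [h], tight at [xi], holds at both ends, so [zeta - xi] vanishes on it. *)
  have [t t0] := near_coordinates_line (xi - zeta)
    (P := fun eta => affine_hull F eta -> F eta) Fnear.
  have /[swap] /[apply] : affine_hull F (xi + t *: (xi - zeta)).
    apply: affine_hull_shift_span => //; exists [:: zeta - xi].
      by move=> x; rewrite inE => /eqP ->; exists zeta.
    by rewrite span_seq1 -opprB scalerN -scaleNr memvZ // memv_line.
  move=> /FP /(_ h hs); have := FP _ Fzeta h hs.
  rewrite /half_space /= !add_lfunE scale_lfunE !add_lfunE !opp_lfunE xih.
  rewrite lerDl pmulr_rge0 // subr_ge0 => le1 le2.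
  by apply/eqP; rewrite subr_eq0; apply/eqP/le_anti/andP; split.
exists (active_face s xi); split; first exact: is_face_active_face.
  exact: relative_interior_active_face.
have [t t0 tF] := polyhedron_step xis eta0.
exists [:: t *: eta].
  move=> x; rewrite inE => /eqP ->.
  by exists (xi + t *: eta); rewrite // addrAC subrr add0r.
by rewrite span_seq1 -[eta in eta \in _](scalerK (lt0r_neq0 t0)) memvZ // memv_line.
Qed.

Lemma face_direction_sub_direction s xi :
  polyhedron s xi ->
  face_direction (polyhedron s) xi `<=` direction (polyhedron s).
Proof.
move=> xis eta [F [[_ [v [c [_ FE]]]] _ [r rF etar]]].
apply: (direction_linear_span xis); exists r => // x /rF [zeta Fzeta <-].
by exists zeta => //; move: Fzeta; rewrite FE => -[].
Qed.

Lemma face_direction_anti s xi eta :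
  polyhedron s xi -> polyhedron s eta -> {subset active s xi <= active s eta} ->
  face_direction (polyhedron s) eta `<=` face_direction (polyhedron s) xi.
Proof.
move=> xis etas sub zeta /(face_directionP _ etas) zeta0.
by apply/(face_directionP _ xis) => h /sub /zeta0.
Qed.

(** * Reaching a vertex *)

Lemma exists_new_active s xi eta h0 : polyhedron s xi ->
  {in active s xi, forall h, (eta h.1 : R) = 0} ->
  h0 \in s -> (eta h0.1 : R) < 0 ->
  exists2 zeta, active_face s xi zeta &
    exists2 h, h \in active s zeta & h \notin active s xi.
Proof.
move=> xis eta0 h0s h0lt.
have i0P : (index h0 s < size s)%N by rewrite index_mem.
pose f (i : 'I_(size s)) := nth 0 s i.
have f0 : (eta (f (Ordinal i0P)).1 : R) < 0 by rewrite /f /= nth_index.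
(* As in the ratio test of the simplex method, [r i] is the time at which the ray from [xi] along
   [eta] meets constraint [i]; the least one is taken among the constraints that [eta] decreases. *)
pose r i := ((xi (f i).1 : R) - (f i).2) / - (eta (f i).1 : R).
have := @arg_minP _ _ _ (Ordinal i0P) (fun i => (eta (f i).1 : R) < 0) r f0.
case=> i ilt imin.
have fs j : f j \in s by apply: mem_nth.
have ri0 : 0 <= r i.
  by rewrite divr_ge0 ?oppr_ge0 ?(ltW ilt) // subr_ge0; apply: xis; apply: fs.
have zE h : ((xi + r i *: eta) h.1 : R) = (xi h.1 : R) + r i * (eta h.1 : R).
  by rewrite add_lfunE scale_lfunE.
exists (xi + r i *: eta).
  split=> [h hs|h ha]; last first.
    by rewrite zE eta0 // mulr0 addr0; case/andP: ha => _ /eqP.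
  (* A constraint that [eta] does not decrease stays valid; any other is met no earlier than time
     [r i]. *)
  rewrite /half_space /= zE; have [eta_ge|eta_lt] := leP 0 (eta h.1 : R).
    by rewrite (le_trans (xis h hs)) // lerDl mulr_ge0.
  have hP : (index h s < size s)%N by rewrite index_mem.
  have := imin (Ordinal hP); rewrite /f /= nth_index // => /(_ eta_lt).
  rewrite {2}/r /f /= nth_index // ler_pdivlMr ?oppr_gt0 //.
  by rewrite mulrN lerBrDr addrC lerBlDr addrC.
exists (f i); last by apply/negP => /eta0 fi0; move: ilt; rewrite fi0 ltxx.
by rewrite inE fs zE /r invrN mulrN mulNr divfK ?subKr /= ?eqxx ?lt_eqF.
Qed.

(** Induction on the number of inactive constraints: either the active ones already isolate [xi], or
    a move within the current face activates another. *)
Lemma exists_vertex_above s xi :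
  (exists eta, is_vertex (polyhedron s) eta) -> polyhedron s xi ->
  exists2 eta, is_vertex (polyhedron s) eta & {subset active s xi <= active s eta}.
Proof.
move=> [x0 [_ [v0 [c0 [Pvc x0E]]]]].
have [n] := ubnP (count [predC active s xi] s).
elim: n xi => // n IHn xi le_n xis.
have [[eta [eta_neq0 eta0]]|noeta] := pselect (exists eta : gdual, eta != 0 /\
    {in active s xi, forall h, (eta h.1 : R) = 0}); last first.
  exists xi => //; rewrite /is_vertex.
  suff <- : active_face s xi = [set xi] by apply: is_face_active_face.
  apply/seteqP; split=> [zeta [_ zetaE]|_ ->]; last first.
    by split=> // h /andP[_ /eqP].
  apply/eqP; rewrite -subr_eq0; apply/negP => /negP zxi; apply: noeta.
  exists (zeta - xi); split=> // h ha.
  rewrite add_lfunE opp_lfunE zetaE //; case/andP: ha => _ /eqP ->.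
  by rewrite subrr.
(* Otherwise the polyhedron contains the line through the vertex [x0] along [eta]. The inequality
   exposing [x0] holds at [x0 + eta] and [x0 - eta], so [eta v0 = 0] and [x0 + eta] lies in the face
   [[set x0]], against [eta != 0]. *)
have [h1 h1s h1neq0] : exists2 h, h \in s & (eta h.1 : R) != 0.
  apply: contrapT => noh; have etas0 h : h \in s -> (eta h.1 : R) = 0.
    by move=> hs; apply/eqP; apply: contrapT => /negP ?; apply: noh; exists h.
  have [x0s x0c] : (polyhedron s `&` [set xi | (xi v0 : R) = c0]) x0 by rewrite -x0E.
  have x0D t : polyhedron s (x0 + t *: eta).
    move=> h /= hs; rewrite /half_space /= add_lfunE scale_lfunE etas0 //.
    by rewrite scaler0 addr0; apply: x0s.
  have : (x0 + 1 *: eta) = x0.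
    suff : [set x0] (x0 + 1 *: eta) by [].
    rewrite x0E; split=> //=.
    have := Pvc _ (x0D 1); have := Pvc _ (x0D (-1)).
    rewrite /half_space /= !add_lfunE !scale_lfunE x0c scale1r scaleN1r.
    rewrite lerDl lerDl oppr_ge0 => le1 le2.
    by rewrite (@le_anti _ _ (eta v0 : R) 0) ?addr0 ?le1.
  by rewrite scale1r -[RHS]addr0 => /addrI/eqP; apply/negP.
(* Replacing [eta] by its opposite if needed makes some constraint decrease, so that the ray leaves
   the polyhedron. *)
have [eta' eta'0 [h0 h0s h0lt]] : exists2 eta' : gdual,
    {in active s xi, forall h, (eta' h.1 : R) = 0} &
    exists2 h0, h0 \in s & (eta' h0.1 : R) < 0.
  move: h1neq0; rewrite neq_lt => /orP[lt0|gt0].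
    by exists eta => //; exists h1.
  exists (- eta); first by move=> h /eta0; rewrite opp_lfunE => ->; rewrite oppr0.
  by exists h1; rewrite // opp_lfunE oppr_lt0.
have [zeta [zetas zetaE] [h hz hxi]] := exists_new_active xis eta'0 h0s h0lt.
have sub : {subset active s xi <= active s zeta}.
  by move=> k ka; rewrite inE (zetaE k ka) eqxx andbT; case/andP: ka.
have [|rho rhov rhosub] := IHn zeta _ zetas; last first.
  by exists rho => // k /sub /rhosub.
rewrite -ltnS; apply: leq_trans le_n; rewrite ltnS.
apply: count_ltn_sub => [k|]; first by apply: contra => /sub.
exists h; first by case/andP: hz.
by apply/andP; split; [exact: hxi|apply/negPn; exact: hz].
Qed.

End Polyhedron.

Theorem lemmaA15 (R : realType) (g : vectType R) (gZ : set g)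
    (P1 P2 : set 'Hom(g, R^o))
    (hgZ : is_lattice gZ)
    (hP1 : rational_polyhedron gZ P1)
    (hP2 : rational_polyhedron gZ P2)
    (hne : P1 `&` P2 !=set0)
    (hvert : exists xi, is_vertex (P1 `&` P2) xi) :
  integrally_transverse gZ P1 P2 <->
  (forall xi, is_vertex (P1 `&` P2) xi ->
     integrally_transverse_at gZ P1 P2 xi).
Proof.
have vertex_mem xi : is_vertex (P1 `&` P2) xi -> (P1 `&` P2) xi.
  move=> [_ [v [c [_ xiE]]]].
  by have [] : (P1 `&` P2 `&` [set eta | (eta v : R) = c]) xi by rewrite -xiE.
split=> [transP xi /vertex_mem|transV xi xiP]; first exact: transP.
have [[s1 _ P1E] [s2 _ P2E]] := (hP1, hP2).
(* Concatenating the constraints lets one vertex serve both polyhedra: the inclusion of active sets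
   restricts to [s1] and to [s2]. *)
have PE : P1 `&` P2 = polyhedron (s1 ++ s2) by rewrite polyhedron_cat P1E P2E.
have [eta etav sub] : exists2 eta, is_vertex (P1 `&` P2) eta &
    {subset active (s1 ++ s2) xi <= active (s1 ++ s2) eta}.
  by rewrite PE in hvert xiP *; apply: exists_vertex_above.
have [xi1 xi2] := xiP; have [eta1 eta2] := vertex_mem _ etav.
have sub1 : {subset active s1 xi <= active s1 eta}.
  move=> h /andP[hs xih]; rewrite inE hs.
  by have /andP[] : h \in active (s1 ++ s2) eta by apply: sub; rewrite inE mem_cat hs.
have sub2 : {subset active s2 xi <= active s2 eta}.
  move=> h /andP[hs xih]; rewrite inE hs.
  by have /andP[] : h \in active (s1 ++ s2) eta by apply: sub; rewrite inE mem_cat hs orbT.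
have le1 := face_direction_anti; have le2 := face_direction_sub_direction.
rewrite /integrally_transverse_at; apply/seteqP; split.
  apply: minkowski_sumS; apply: setSI.
    by move: xi1; rewrite P1E; apply: le2.
  by move: xi2; rewrite P2E; apply: le2.
(* Transversality at the vertex [eta] replaces the sum for the directions by the sum at [eta], which
   is contained in the sum at [xi]. *)
rewrite -(transV _ etav); apply: minkowski_sumS; apply: setSI.
  by move: xi1 eta1; rewrite P1E => *; apply: le1 sub1.
by move: xi2 eta2; rewrite P2E => *; apply: le1 sub2.
Qed.
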